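(* Let $G$ be the generalized Baumslag-Solitar group presented by a finite labeled tree $T$, with vertex groups $\langle x_v\rangle$, $v\in V(T)$. For every pair of distinct vertices $u,v$ of $T$, let $H_{(u,v)}$ be the subgroup of $G$ generated by the vertex groups $\langle x_u\rangle$ and $\langle x_v\rangle$, and let $S_{(u,v)}$ be the set of commutators attached to this subgroup as described in the context. Let $S=\bigcup_{u\neq v}S_{(u,v)}$. Then $\gamma_\omega(G)$ is the normal closure of $S$ in $G$.
   Context: Commutators are $[a,b]=a^{-1}b^{-1}ab$. $\gamma_i(G)$ is the $i$-th term of the lower central series ($\gamma_1(G)=G$, $\gamma_{i+1}(G)=[\gamma_i(G),G]$) and $\gamma_\omega(G)=\bigcap_{i\ge 1}\gamma_i(G)$. GBS group presented by a labeled tree: let $T$ be a finite tree in which each edge $e$ with endpoints $u,v$ carries two nonzero integer labels, $\lambda_{e,u}$ (at $u$) and $\lambda_{e,v}$ (at $v$). The associated group is $G=\langle x_v\ (v\in V(T)) \mid x_u^{\lambda_{e,u}}=x_v^{\lambda_{e,v}}\ \text{for every edge } e=\{u,v\}\rangle$; it is the fundamental group of the corresponding tree of infinite cyclic groups. The vertex groups $\langle x_v\rangle$ are infinite cyclic subgroups of $G$, and any two of them intersect in a nontrivial subgroup. The sets $S_{(u,v)}$: for distinct vertices $u,v$ write $a=x_u$, $b=x_v$, and let $k,l$ be the positive integers with $\langle a\rangle\cap\langle b\rangle=\langle a^k\rangle=\langle b^l\rangle$. Write the prime factorizations as $k=p_1^{\kappa_1}\cdots p_s^{\kappa_s}q_{s+1}^{\kappa_{s+1}}\cdots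 q_n^{\kappa_n}$ and $l=p_1^{\lambda_1}\cdots p_s^{\lambda_s}r_{s+1}^{\lambda_{s+1}}\cdots r_m^{\lambda_m}$, where $p_1,\dots,p_s$ are the primes dividing both $k$ and $l$. Then $$S_{(u,v)}=\{[a^{c_i},b^{d_i}],\ [b^{e_i},a^{f_i}] : i\in\{1,\dots,s\}\},$$ where $c_i=p_i^{\kappa_i}$, $d_i=p_1^{\lambda_1}\cdots p_{i-1}^{\lambda_{i-1}}p_{i+1}^{\lambda_{i+1}}\cdots p_s^{\lambda_s}$, $e_i=p_i^{\lambda_i}$, $f_i=p_1^{\kappa_1}\cdots p_{i-1}^{\kappa_{i-1}}p_{i+1}^{\kappa_{i+1}}\cdots p_s^{\kappa_s}$.
   Formalization: When k and l have no common prime (s = 0), S_(u,v) is taken to be {[a,b]} instead of the empty set; with the empty set the claim fails for the trefoil group ⟨a,b | a²=b³⟩, where S is empty but γ_ω(G) = [G,G] is nontrivial. *)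

(* Defs.v *)
(* MathComp, with sets and classical logic from mathcomp-classical. *)
From HB Require Import structures.
From mathcomp Require Import all_boot all_order all_algebra.
From mathcomp Require Import generic_quotient.
From mathcomp Require Import boolp classical_sets.

Set Implicit Arguments.
Unset Strict Implicit.
Unset Printing Implicit Defensive.

Local Open Scope group_scope.
Local Open Scope nat_scope.
Local Open Scope classical_set_scope.

Section Subgroups.
Variable G : groupType.
Implicit Types (H K A : set G).

Definition subgroup H : Prop :=
  [/\ H 1%g, (forall x y, H x -> H y -> H (x * y)%g)
    & (forall x, H x -> H (x^-1)%g)].

Definition normal_subgroup H : Prop :=
  subgroup H /\ (forall x y, H x -> H (x ^ y)%g).

Definition subgroup_gen A : set G := smallest subgroup A.

Definition normal_closure A : set G := smallest normal_subgroup A.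

Definition commutator_subgroup H K : set G :=
  subgroup_gen [set [~ x, y]%g | x in H & y in K].

(* Indexed from 1; gamma 0 is a junk value, equal to gamma 1. *)
Definition gamma (i : nat) : set G :=
  iter i.-1 (fun H => commutator_subgroup H setT) setT.

Definition gamma_omega : set G := \bigcap_(i in [set i | 1 <= i]) gamma i.

End Subgroups.

Section Presentation.
Variable X : choiceType.

(* The letter (x, false) stands for x and (x, true) for x^-1. *)
Local Notation word := (seq (X * bool)).

Definition word_inv (w : word) : word := rev [seq (a.1, ~~ a.2) | a <- w].

Definition word_exp (x : X) (n : int) : word := nseq `|n|%N (x, (n < 0)%R).

Variable R : set (word * word).

Inductive word_cong : word -> word -> Prop :=
| WRel r : R r -> word_cong r.1 r.2
| WCancel x b : word_cong [:: (x, b); (x, ~~ b)] [::]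
| WRefl w : word_cong w w
| WSym v w : word_cong v w -> word_cong w v
| WTrans u v w : word_cong u v -> word_cong v w -> word_cong u w
| WCat v v' w w' :
    word_cong v v' -> word_cong w w' -> word_cong (v ++ w) (v' ++ w').

Definition word_eq (v w : word) : bool := `[< word_cong v w >].

Lemma word_eq_refl : reflexive word_eq.
Proof. by move=> w; apply/asboolP/WRefl. Qed.

Lemma word_eq_sym : symmetric word_eq.
Proof. by move=> v w; apply/asboolP/asboolP; apply: WSym. Qed.

Lemma word_eq_trans : transitive word_eq.
Proof. by move=> v u w /asboolP uv /asboolP vw; apply/asboolP/(WTrans uv vw). Qed.

Canonical word_equiv := EquivRel word_eq word_eq_refl word_eq_sym word_eq_trans.

(* The group < X | v = w for (v, w) in R >. *)
Definition presented : Type := {eq_quot word_equiv}%qT.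
HB.instance Definition _ := Choice.on presented.

Definition word_class (w : word) : presented := (\pi_{eq_quot word_equiv} w)%qT.
Definition class_word (g : presented) : word :=
  repr (g : {eq_quot word_equiv}%qT).

Lemma word_classP v w : word_class v = word_class w <-> word_cong v w.
Proof.
split=> [/eqquotP/asboolP //|vw].
by apply/eqquotP; apply/asboolP.
Qed.

Lemma class_wordK : cancel class_word word_class.
Proof. exact: reprK. Qed.

Lemma class_word_cong w : word_cong (class_word (word_class w)) w.
Proof. by apply/word_classP; rewrite class_wordK. Qed.

Lemma word_invK : involutive word_inv.
Proof.
move=> u; rewrite /word_inv map_rev revK -map_comp -[RHS]map_id.
by apply: eq_map => -[x b] /=; rewrite negbK.
Qed.

Lemma word_mulV u : word_cong (u ++ word_inv u) [::].
Proof.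
elim: u => [|[x b] u IHu]; first exact: WRefl.
rewrite /word_inv /= rev_cons -cats1 -/(word_inv u).
apply: WTrans (WCancel x b).
rewrite -[X in word_cong X _]/([:: (x, b)] ++ (u ++ word_inv u ++ [:: (x, ~~ b)])).
rewrite -[X in word_cong _ X]/([:: (x, b)] ++ [::] ++ [:: (x, ~~ b)]) (catA u).
by apply: WCat; [apply: WRefl | apply: WCat IHu _; apply: WRefl].
Qed.

Lemma word_mulVl u : word_cong (word_inv u ++ u) [::].
Proof. by rewrite -[X in _ ++ X]word_invK; apply: word_mulV. Qed.

Lemma word_inv_cong v w : word_cong v w -> word_cong (word_inv v) (word_inv w).
Proof.
move=> vw; apply: (@WTrans _ (word_inv v ++ (w ++ word_inv w))).
  rewrite -[X in word_cong X _]cats0; apply: WCat; first exact: WRefl.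
  exact/WSym/word_mulV.
rewrite catA -[X in word_cong _ X]cat0s; apply: WCat; last exact: WRefl.
apply: WTrans (word_mulVl v).
by apply: WCat; [apply: WRefl | apply: WSym].
Qed.

Definition pres_one : presented := word_class [::].
Definition pres_mul (g h : presented) : presented :=
  word_class (class_word g ++ class_word h).
Definition pres_inv (g : presented) : presented :=
  word_class (word_inv (class_word g)).

Lemma pres_mulE v w : pres_mul (word_class v) (word_class w) = word_class (v ++ w).
Proof. by apply/word_classP; apply: WCat; apply: class_word_cong. Qed.

Lemma pres_invE w : pres_inv (word_class w) = word_class (word_inv w).
Proof. exact/word_classP/word_inv_cong/class_word_cong. Qed.

Lemma pres_mulA : associative pres_mul.
Proof.
move=> f g h; rewrite -(class_wordK f) -(class_wordK g) -(class_wordK h).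
by rewrite !pres_mulE catA.
Qed.

Lemma pres_mul1g : left_id pres_one pres_mul.
Proof. by move=> g; rewrite -(class_wordK g) pres_mulE. Qed.

Lemma pres_mulg1 : right_id pres_one pres_mul.
Proof. by move=> g; rewrite -(class_wordK g) pres_mulE cats0. Qed.

Lemma pres_mulVg : left_inverse pres_one pres_inv pres_mul.
Proof.
move=> g; rewrite -(class_wordK g) pres_invE pres_mulE.
exact/word_classP/word_mulVl.
Qed.

Lemma pres_mulgV : right_inverse pres_one pres_inv pres_mul.
Proof.
move=> g; rewrite -(class_wordK g) pres_invE pres_mulE.
exact/word_classP/word_mulV.
Qed.

HB.instance Definition _ := isGroup.Build presented
  pres_mulA pres_mul1g pres_mulg1 pres_mulVg pres_mulgV.

Definition pres_gen (x : X) : presented := word_class [:: (x, false)].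

End Presentation.

(* The edges are the pairs {u, v} with edge u v, and label u v is then the label
   of the edge {u, v} at its endpoint u; label is irrelevant on other pairs. In
   the acyclicity condition, cycles of size 2 only go back and forth on an edge. *)
Record labeled_tree := LabeledTree {
  vertex : finType;
  edge : rel vertex;
  label : vertex -> vertex -> int;
  vertex_gt0 : 0 < #|vertex|;
  edge_sym : symmetric edge;
  edge_irr : irreflexive edge;
  edge_connected : forall u v, connect edge u v;
  edge_acyclic : forall c, ucycle edge c -> size c <= 2;
  label_neq0 : forall u v, edge u v -> label u v != 0%R
}.

Section GBS.
Variable T : labeled_tree.
Implicit Types u v : vertex T.

Definition gbs_relations : set (seq (vertex T * bool) * seq (vertex T * bool)) :=
  [set r | exists u v, edge u v /\
    r = (word_exp u (label u v), word_exp v (label v u))].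

Definition gbs : groupType := presented gbs_relations.

Definition gbs_gen v : gbs := pres_gen gbs_relations v.

End GBS.

Section Commutators.
Variable G : groupType.
Implicit Types (a b : G) (k l p : nat).

Definition common_primes k l : seq nat := [seq p <- primes k | p %| l].

Definition prime_component p k : nat := p ^ logn p k.

Definition other_components p k l : nat :=
  \prod_(q <- common_primes k l | q != p) prime_component q l.

(* When k and l have no common prime, the family indexed by the common primes is
   empty, and the degenerate case of the construction is the commutator [a, b]
   itself (all exponents being empty products). It has to be there: in the
   trefoil group <a, b | a^2 = b^3>, gamma_omega is the commutator subgroup, a
   free group of rank 2. *)
Definition commutators a b k l : set G :=
  if coprime k l then [set [~ a, b]%g] else
  [set g | exists2 p, p \in common_primes k l &
     g = [~ a ^+ prime_component p k, b ^+ other_components p k l]%g \/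
     g = [~ b ^+ prime_component p l, a ^+ other_components p l k]%g].

(* The exponents k and l are characterized rather than chosen; where they exist,
   they are unique as soon as a and b have infinite order. *)
Definition pair_commutators a b : set G :=
  [set g | exists k l, [/\ 0 < k, 0 < l,
     subgroup_gen [set a] `&` subgroup_gen [set b] = subgroup_gen [set (a ^+ k)%g],
     subgroup_gen [set a] `&` subgroup_gen [set b] = subgroup_gen [set (b ^+ l)%g]
   & commutators a b k l g]].

End Commutators.

Definition gbs_commutators (T : labeled_tree) : set (gbs T) :=
  [set g | exists u v : vertex T,
     u != v /\ pair_commutators (gbs_gen u) (gbs_gen v) g].

Arguments gamma_omega G : clear implicits.
Arguments gbs_commutators T : clear implicits.

(* Main.v *)
Require Import Defs.
From HB Require Import structures.
From mathcomp Require Import all_boot all_order all_algebra.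
From mathcomp Require Import boolp classical_sets functions.
From mathcomp Require Import zify ring.

(* Fix nonzero integers rho_v with rho_u * label u v = rho_v * label v u. Some
   powers x_v^(m_v) all equal the same central element z, so that modulo z and the
   normal closure N of S the x_v have finite orders dividing some C. There the
   relations S say exactly that the p-part of x_u commutes with the q-part of x_v
   for p <> q, so the projection of G onto G/N<z> is the product of commuting
   homomorphisms phi_p, one for each prime p dividing C, sending x_v to its p-part.
   Each phi_p kills gamma_omega: over the group ring A in characteristic p, where
   (1 + t)^(p^n) = 1 + t^(p^n), the t_v = x_v - 1 can be given weights making the
   relations homogeneous, and the resulting grading raises the degree under
   commutators. Hence gamma_omega lies in N<z>, and in N because z has infinite
   order in the abelianization. Conversely, in a nilpotent group x and y commute
   as soon as x^m commutes with y and y^n with x for coprime m and n. *)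

Set Implicit Arguments.
Unset Strict Implicit.
Unset Printing Implicit Defensive.

Import Order.TTheory GRing.Theory Num.Theory.

Local Open Scope classical_set_scope.
Local Open Scope group_scope.

Local Notation "{ 'hom' G -> H }" := (UMagmaMorphism.type G H)
  (at level 0, G at level 98, H at level 99).

(** * Groups, presentations and the lower central series *)

Section IntegerPowers.
Variable G : groupType.
Implicit Types (x y : G) (m n : int).

Definition zexp x n : G :=
  match n with Posz k => x ^+ k | Negz k => x ^- k.+1 end.

Lemma zexp_opp_nat x (k : nat) : zexp x (- k%:Z)%R = x ^- k.
Proof. by case: k => [|k] //; rewrite oppr0 expg0 invg1. Qed.

Lemma zexp1 x : zexp x 1%R = x. Proof. by []. Qed.

Lemma commute_zexp x y n : commute x y -> commute x (zexp y n).
Proof. by case: n => k xy; [apply: commuteX | apply/commuteV/commuteX]. Qed.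

Lemma zexpS x n : zexp x (n + 1)%R = x * zexp x n.
Proof.
case: n => [k|[|k]]; first by rewrite -PoszD addn1 /= expgS.
  by rewrite /= expg1 divgg.
have -> : (Negz k.+1 + 1)%R = (- k.+1%:Z)%R by lia.
by rewrite zexp_opp_nat /= (expgSr x k.+1) invgM mulVKg.
Qed.

Lemma zexpP x n : zexp x (n - 1)%R = x^-1 * zexp x n.
Proof. by have := zexpS x (n - 1)%R; rewrite subrK => ->; rewrite mulKg. Qed.

Lemma zexpD x m n : zexp x (m + n)%R = zexp x m * zexp x n.
Proof.
elim/int_rect: m => [|m IHm|m IHm]; first by rewrite add0r mul1g.
  by rewrite intS (addrC 1%R) addrAC !zexpS IHm mulgA.
by rewrite intS opprD (addrC (- 1)%R) addrAC !zexpP IHm mulgA.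
Qed.

Lemma zexpN x n : zexp x (- n)%R = (zexp x n)^-1.
Proof. by apply/esym/mulg1_eq; rewrite -zexpD subrr. Qed.

Lemma zexpM x m n : zexp x (m * n)%R = zexp (zexp x m) n.
Proof.
elim/int_rect: n => [|n IHn|n IHn]; first by rewrite mulr0.
  by rewrite intS mulrDr mulr1 zexpD (addrC 1%R) zexpS IHn.
by rewrite intS opprD mulrDr mulrN1 zexpD (addrC (- 1)%R) zexpP IHn (zexpN x m).
Qed.

Lemma zexpMn x n (k : nat) : zexp x (n * k%:Z)%R = zexp x n ^+ k.
Proof. exact: zexpM. Qed.

Lemma zexpMl x n (k : nat) : zexp x (k%:Z * n)%R = zexp (x ^+ k) n.
Proof. exact: zexpM. Qed.

End IntegerPowers.

Lemma hom_zexp (G H : groupType) (f : {hom G -> H}) x n :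
  f (zexp x n) = zexp (f x) n.
Proof. by case: n => k /=; rewrite ?gmulfV gmulfXn. Qed.

(** The bundled structure asks for compatibility with [x / y]; cancellation gives [f 1 = 1], hence
    inverses are preserved too. *)
Lemma morph_hom (G H : groupType) (f : G -> H) :
  {morph f : x y / x * y} -> exists F : {hom G -> H}, F =1 f.
Proof.
move=> fM; have f1 : f 1 = 1 by apply: (mulgI (f 1)); rewrite -fM !mulg1.
have fF : {morph f : x y / x / y}.
  move=> x y; rewrite fM; congr (_ * _); apply/esym/mulg1_eq.
  by rewrite -fM mulgV.
by exists (HB.pack_for (UMagmaMorphism.type G H) f (isGroupMorphism.Build G H f fF)).
Qed.

Section UniversalProperty.
Variables (X : choiceType) (R : set (seq (X * bool) * seq (X * bool))).

Section WordValue.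
Variables (H : groupType) (f : X -> H).

Definition word_value (w : seq (X * bool)) : H :=
  \prod_(a <- w) (if a.2 then (f a.1)^-1 else f a.1).

Lemma word_value_cat v w : word_value (v ++ w) = word_value v * word_value w.
Proof. exact: big_cat. Qed.

Lemma word_value_exp x n : word_value (word_exp x n) = zexp (f x) n.
Proof.
rewrite /word_value /word_exp big_nseq; case: n => k /=.
  by rewrite iter_mulg_1.
by rewrite iter_mulg_1 -expgS expVgn.
Qed.

Lemma word_cong_value v w : (forall r, R r -> word_value r.1 = word_value r.2) ->
  word_cong R v w -> word_value v = word_value w.
Proof.
move=> fR; elim=> {v w} //.
- move=> x b; rewrite /word_value !big_cons big_nil mulg1 /=.
  by case: b; rewrite ?mulVg ?mulgV.
- by move=> ? ? ? _ -> _ ->.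
- by move=> ? ? ? ? _ vv _ ww; rewrite !word_value_cat vv ww.
Qed.

(** Von Dyck's theorem: the value of the chosen representative depends only on its class, and
    concatenation gives multiplicativity. *)
Lemma presented_lift : (forall r, R r -> word_value r.1 = word_value r.2) ->
  exists F : {hom presented R -> H},
    (forall w, F (word_class R w) = word_value w).
Proof.
move=> fR; pose F (g : presented R) := word_value (class_word g).
have FE w : F (word_class R w) = word_value w.
  exact/(word_cong_value fR)/class_word_cong.
have [|F' F'E] := @morph_hom _ _ F; last by exists F' => w; rewrite F'E.
move=> g h; rewrite -(class_wordK g) -(class_wordK h).
by rewrite [_ * _]pres_mulE !FE word_value_cat.
Qed.

End WordValue.

Lemma word_class_cat v w :
  word_class R (v ++ w) = word_class R v * word_class R w.
Proof. by rewrite [_ * _]pres_mulE. Qed.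

Lemma word_class_letter x b :
  word_class R [:: (x, b)] = if b then (pres_gen R x)^-1 else pres_gen R x.
Proof. by case: b => //; rewrite [_^-1]pres_invE. Qed.

Lemma word_classE w : word_class R w = word_value (pres_gen R) w.
Proof.
elim: w => [|[x b] w IHw]; first by rewrite /word_value big_nil.
rewrite -cat1s word_class_cat IHw /word_value big_cat big_seq1.
by rewrite word_class_letter.
Qed.

Lemma presented_ind (P : set (presented R)) : subgroup P ->
  (forall x, P (pres_gen R x)) -> forall g, P g.
Proof.
move=> [P1 PM PV] Pgen g; rewrite -(class_wordK g).
elim: (class_word g) => [|[x b] w IHw] //.
rewrite -cat1s word_class_cat word_class_letter.
by apply: PM => //; case: b; rewrite //; apply: PV.
Qed.

End UniversalProperty.

Section Subgroups.
Variable G : groupType.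
Implicit Types (H N A : set G).

Lemma subgroupX H : subgroup H -> forall x n, H x -> H (x ^+ n).
Proof.
move=> [H1 HM _] x n Hx; elim: n => [|n IHn]; first exact: H1.
by rewrite expgS; apply: HM.
Qed.

Lemma subgroup_zexp H : subgroup H -> forall x n, H x -> H (zexp x n).
Proof.
move=> sH x [] n Hx; first exact: subgroupX.
by case: (sH) => _ _ HV; apply: (HV); apply: subgroupX.
Qed.

Lemma subgroup_bigcap I (D : set I) (F : I -> set G) :
  (forall i, D i -> subgroup (F i)) -> subgroup (\bigcap_(i in D) F i).
Proof.
move=> sF; split=> [i Di|x y Fx Fy i Di|x Fx i Di]; have [? ? ?] := sF i Di; auto.
Qed.

Lemma normal_bigcap I (D : set I) (F : I -> set G) :
  (forall i, D i -> normal_subgroup (F i)) ->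
  normal_subgroup (\bigcap_(i in D) F i).
Proof.
move=> nF; split; first by apply: subgroup_bigcap => i /nF[].
by move=> x y Fx i Di; have [_] := nF i Di; apply; apply: Fx.
Qed.

Lemma subgroup_gen_subgroup A : subgroup (subgroup_gen A).
Proof. by apply: subgroup_bigcap => i []. Qed.

Lemma normal_closure_normal A : normal_subgroup (normal_closure A).
Proof. by apply: normal_bigcap => i []. Qed.

Lemma normal_setT : normal_subgroup [set: G]. Proof. by []. Qed.

Lemma subgroup_gen1P (x y : G) :
  subgroup_gen [set x] y <-> exists n : int, y = zexp x n.
Proof.
split; last first.
  move=> [n ->]; apply: (subgroup_zexp (subgroup_gen_subgroup [set x])).
  exact: sub_gen_smallest.
apply: (smallest_sub (X := [set y : G | exists n : int, y = zexp x n])); last first.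
  by move=> _ ->; exists 1%R.
split; first by exists 0%R.
  by move=> _ _ [m ->] [n ->]; exists (m + n)%R; rewrite zexpD.
by move=> _ [n ->]; exists (- n)%R; rewrite zexpN.
Qed.

(* The quotient is presented by the words on the elements of G, two words being
   equated when their values agree modulo N. *)
Lemma quotient_exists N : normal_subgroup N ->
  exists (Q : groupType) (q : {hom G -> Q}), forall g, q g = 1 <-> N g.
Proof.
move=> [[N1 NM NV] NJ]; pose val := word_value (fun x : G => x).
pose R := [set r : seq (G * bool) * seq (G * bool) | N (val r.1 / val r.2)].
have NJ' x y : N x -> N (y * x * y^-1).
  by move=> Nx; have := NJ x y^-1 Nx; rewrite conjgE invgK mulgA.
have valM v w : val (v ++ w) = val v * val w by apply: word_value_cat.
have congN v w : word_cong R v w -> N (val v / val w).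
  elim=> {v w} //.
  - move=> x b; rewrite /val /word_value !big_cons big_nil !mulg1 /= invg1 mulg1.
    by case: b; rewrite ?mulVg ?mulgV.
  - by move=> w; rewrite mulgV.
  - by move=> v w _ /NV; rewrite invgM invgK.
  - move=> u v w _ uv _ vw; rewrite -[val u](mulgVK (val v)) -[_ / _]mulgA.
    exact: NM.
  - move=> v v' w w' _ vv _ ww; rewrite !valM invgM.
    have -> : val v * val w * ((val w')^-1 * (val v')^-1) =
      val v * (val w / val w') * (val v)^-1 * (val v / val v').
      by rewrite !mulgA mulgVK.
    by apply: NM => //; apply: NJ'.
have [|q qE] := @morph_hom G (presented R) (pres_gen R).
  move=> x y; rewrite -[RHS]word_class_cat; apply/word_classP.
  apply: (WRel (r := (_, _))); rewrite /R /= /val /word_value !big_cons !big_nil /=.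
  by rewrite !mulg1 mulgV.
exists (presented R), q => g; rewrite qE.
have valg b : val [:: (g, b)] = if b then g^-1 else g.
  by rewrite /val /word_value big_seq1.
split=> [/word_classP/congN|Ng].
  by rewrite valg /val /word_value big_nil invg1 mulg1.
apply/word_classP; apply: (WRel (r := (_, _))).
by rewrite /R /= valg /val /word_value big_nil invg1 mulg1.
Qed.

End Subgroups.

Lemma hom_ker_normal (G H : groupType) (f : {hom G -> H}) :
  normal_subgroup [set g | f g = 1].
Proof.
split; first split=> /= [|x y fx fy|x fx]; first exact: gmulf1.
- by rewrite gmulfM fx fy mulg1.
- by rewrite gmulfV fx invg1.
- by move=> x y /= fx; rewrite gmulfJ fx conj1g.
Qed.

Section LowerCentralSeries.
Variable G : groupType.

Lemma gammaS i :
  @gamma G i.+2 = commutator_subgroup (@gamma G i.+1) setT.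
Proof. by []. Qed.

(** Bounds the series from above by a filtration. The index is shifted: [P 0] corresponds to the
    first term, the whole group. *)
Lemma gamma_sub (P : nat -> set G) : (forall i, subgroup (P i)) ->
    (forall g, P 0 g) -> (forall i x y, P i x -> P i.+1 [~ x, y]) ->
  forall i, @gamma G i.+1 `<=` P i.
Proof.
move=> sP P0 PS; elim=> [|i IHi]; first by move=> g _; apply: P0.
rewrite gammaS; apply: smallest_sub; first exact: sP.
by move=> _ [x gx [y _ <-]]; apply: PS; apply: IHi.
Qed.

Lemma gamma_normal i : normal_subgroup (@gamma G i.+1).
Proof.
elim: i => [|i [sG nG]]; first exact: normal_setT.
rewrite gammaS; split; first exact: subgroup_gen_subgroup.
(* The preimage of the commutator subgroup under conjugation by [y] is a subgroup, so the generating
   commutators are enough. *)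
move=> x y; pose P := [set x | commutator_subgroup (@gamma G i.+1) setT (x ^ y)].
apply: (smallest_sub (X := P)).
  have [H1 HM HV] := subgroup_gen_subgroup
     [set [~ x, y] | x in @gamma G i.+1 & y in setT].
  split; rewrite /P /=; first by rewrite conj1g.
    by move=> u v Hu Hv; rewrite conjMg; apply: HM.
  by move=> u Hu; rewrite conjVg; apply: HV.
move=> _ [u gu [v _ <-]]; rewrite /P /= conjRg; apply: sub_gen_smallest.
by exists (u ^ y); [apply: nG | exists (v ^ y)].
Qed.

Lemma gamma_omega_normal : normal_subgroup (gamma_omega G).
Proof. by apply: normal_bigcap => -[|i] // _; apply: gamma_normal. Qed.

Lemma gamma_commg i x y : @gamma G i.+1 x -> @gamma G i.+2 [~ x, y].
Proof. by move=> gx; apply: sub_gen_smallest; exists x => //; exists y. Qed.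

(* Modulo gamma_(i+1), a commutator [x, y] in gamma_i is central, hence
   [x, y]^m = [x^m, y] = 1 and [x, y]^n = [x, y^n] = 1. *)
Lemma coprime_commg_gamma_omega (x y : G) m n : coprime m n ->
  commute (x ^+ m) y -> commute x (y ^+ n) -> gamma_omega G [~ x, y].
Proof.
move=> co_mn xmy xyn [|i] // _; elim: i => [|i IHi] //.
have [Q [q kerq]] := quotient_exists (gamma_normal i.+1).
apply/kerq; set c := [~ x, y] in IHi *.
have cE : q c = [~ q x, q y] by rewrite gmulfR.
have cZ g : commute (q g) (q c).
  by apply/commute_sym/commgP/eqP; rewrite -gmulfR; apply/kerq; exact: gamma_commg IHi.
have cm : q c ^+ m = 1.
  have : [~ q x ^+ m, q y] = 1.
    by rewrite -gmulfXn -gmulfR; move/commgP/eqP: xmy => ->; rewrite gmulf1.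
  have xy : q x ^ q y = q x * q c by rewrite cE commgEl mulVKg.
  by rewrite commgEl conjXg xy (expgMn _ (cZ x)) mulKg.
have cn : q c ^+ n = 1.
  have : [~ q y ^+ n, q x] = 1.
    rewrite -gmulfXn -gmulfR; move/commute_sym/commgP/eqP: xyn => ->.
    by rewrite gmulf1.
  have yx : q y ^ q x = q y * (q c)^-1 by rewrite cE invgR commgEl mulVKg.
  rewrite commgEl conjXg yx (expgMn _ (commuteV (cZ y))) mulKg expVgn => /eqP.
  by rewrite invg_eq1 => /eqP.
(* Bezout's identity takes a positive first argument; if [m] is 0, coprimality forces [n = 1] and
   [cn] is the claim. *)
case: m n co_mn cm cn {xmy xyn} => [|m] n co_mn cm cn.
  by move: co_mn cn; rewrite /coprime gcd0n => /eqP ->.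
have [k l] := @egcdnP m.+1 n isT; rewrite (eqP co_mn) => kE _.
have : q c ^+ (k * m.+1) = 1 by rewrite mulnC expgnA cm expg1n.
by rewrite kE expgnDr mulnC expgnA cn expg1n mul1g.
Qed.

End LowerCentralSeries.

(** * Graded units over a group ring *)

Section EndomorphismRing.
Local Open Scope ring_scope.
Variable V : zmodType.

Record endo := Endo { endo_fun :> V -> V; endoD : {morph endo_fun : x y / x + y} }.

HB.instance Definition _ := gen_eqMixin endo.
HB.instance Definition _ := gen_choiceMixin endo.

Lemma endoP (f g : endo) : f =1 g -> f = g.
Proof.
case: f g => [f fD] [g gD] /= /funext fg.
by move: fD gD; rewrite fg => fD gD; rewrite (Prop_irrelevance fD gD).
Qed.

Lemma endo_zeroD : {morph (fun=> 0 : V) : x y / x + y : V}.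
Proof. by move=> x y; rewrite addr0. Qed.
Lemma endo_oneD : {morph (fun x => x : V) : x y / x + y : V}.
Proof. by []. Qed.
Lemma endo_addD (f g : endo) : {morph (fun x => f x + g x) : x y / x + y}.
Proof. by move=> x y; rewrite !endoD addrACA. Qed.
Lemma endo_oppD (f : endo) : {morph (fun x => - f x) : x y / x + y}.
Proof. by move=> x y; rewrite endoD opprD. Qed.
Lemma endo_mulD (f g : endo) : {morph (fun x => f (g x)) : x y / x + y}.
Proof. by move=> x y; rewrite !endoD. Qed.

Let zero := Endo endo_zeroD.
Let one := Endo endo_oneD.
Let add f g := Endo (endo_addD f g).
Let opp f := Endo (endo_oppD f).
Let mul f g := Endo (endo_mulD f g).

Let addA : associative add. Proof. by move=> f g h; apply: endoP => x; apply: addrA. Qed.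
Let addC : commutative add. Proof. by move=> f g; apply: endoP => x; apply: addrC. Qed.
Let add0 : left_id zero add. Proof. by move=> f; apply: endoP => x; apply: add0r. Qed.
Let addN : left_inverse zero opp add.
Proof. by move=> f; apply: endoP => x; apply: addNr. Qed.
Let mulA : associative mul. Proof. by move=> f g h; apply: endoP. Qed.
Let mul1 : left_id one mul. Proof. by move=> f; apply: endoP. Qed.
Let mul1' : right_id one mul. Proof. by move=> f; apply: endoP. Qed.
Let mulDl : left_distributive mul add. Proof. by move=> f g h; apply: endoP. Qed.
Let mulDr : right_distributive mul add.
Proof. by move=> f g h; apply: endoP => x; apply: endoD. Qed.

HB.instance Definition _ := GRing.isZmodule.Build endo addA addC add0 addN.
HB.instance Definition _ :=
  GRing.Zmodule_isPzRing.Build endo mulA mul1 mul1' mulDl mulDr.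

End EndomorphismRing.

(* K acts faithfully on the functions from K to 'F_p by translations; this ring
   replaces the group algebra of K over 'F_p. *)
Lemma group_ring_exists (K : groupType) p : prime p ->
  exists (A : nzRingType) (j : K -> A),
    [/\ p \in [pchar A]%R, j 1 = 1%R, {morph j : x y / x * y >-> (x * y)%R}
      & forall x, j x = 1%R -> x = 1].
Proof.
move=> p_pr; pose V := K -> 'F_p.
(* The indicator function of 1 shows both that the ring is nonzero and that the translations act
   faithfully. *)
have delta : exists2 f : V, f 1 = 1%R & forall x, x != 1 -> f x = 0%R.
  by exists (fun x : K => (x == 1%g)%:R%R) => [|x /negbTE ->]; rewrite ?eqxx.
have [f f1 f0] := delta.
have nz : (1 : endo V)%R != 0%R.
  apply/eqP => /(congr1 (fun e : endo V => e f 1)).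
  by rewrite /= f1 => /eqP; rewrite oner_eq0.
pose A := HB.pack_for nzRingType (endo V) (GRing.PzSemiRing_isNonZero.Build (endo V) nz).
have jD x : {morph (fun (f : V) h => f (h * x)) : f g / (f + g)%R} by [].
pose j x : A := Endo (jD x).
exists A, j; split.
- apply/andP; split=> //; apply/eqP; apply: endoP => g; apply/funext => x.
  have natE n : (n%:R%R : endo V) g x = (g x *+ n)%R.
    by elim: n => [|n IHn] //; rewrite !mulrS -IHn.
  by rewrite [LHS]natE -mulr_natr pchar_Fp_0 // mulr0.
- by apply: endoP => g; apply/funext => h /=; rewrite mulg1.
- by move=> x y; apply: endoP => g; apply/funext => h /=; rewrite mulgA.
- move=> x /(congr1 (fun e : endo V => e f 1)) /=; rewrite mul1g f1 => fx.
  by apply/eqP; apply: contraTT isT => /f0 fx0; move/eqP: fx; rewrite fx0 eq_sym oner_eq0.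
Qed.

Section UnitGroup.
Local Open Scope ring_scope.
Variable A : pzRingType.

(** Each unit carries its two-sided inverse, which makes sense over any ring, commutative or not; by
    [uval_inj] equality depends on the first component only. *)
Definition unit_group := {a : A * A | (a.1 * a.2 == 1) && (a.2 * a.1 == 1)}.
HB.instance Definition _ := Choice.on unit_group.

Definition uval (u : unit_group) : A := (sval u).1.
Definition uval_inv (u : unit_group) : A := (sval u).2.

Lemma uvalV u : uval u * uval_inv u = 1.
Proof. by have /andP[/eqP] := valP u. Qed.
Lemma uvalVl u : uval_inv u * uval u = 1.
Proof. by have /andP[_ /eqP] := valP u. Qed.

Lemma uval_inj : injective uval.
Proof.
move=> u v uv; apply: val_inj; rewrite /= [LHS]surjective_pairing [RHS]surjective_pairing.
congr (_, _) => //; rewrite -/(uval_inv u) -/(uval_inv v).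
by rewrite -[LHS]mul1r -(uvalVl v) -uv -mulrA uvalV mulr1.
Qed.

Definition unit_pair a b (ab : (a * b == 1) && (b * a == 1)) : unit_group :=
  exist (fun a : A * A => (a.1 * a.2 == 1) && (a.2 * a.1 == 1)) (a, b) ab.

Lemma unit_group_exists a b : a * b = 1 -> b * a = 1 -> exists u, uval u = a.
Proof.
move=> ab ba; have abP : (a * b == 1) && (b * a == 1) by rewrite ab ba !eqxx.
by exists (unit_pair abP).
Qed.

Lemma unit_mul_subproof u v (a := uval u * uval v) (b := uval_inv v * uval_inv u) :
  (a * b == 1) && (b * a == 1).
Proof.
by rewrite /a /b !mulrA -(mulrA (uval u)) uvalV mulr1 uvalV
  -(mulrA (uval_inv v)) uvalVl mulr1 uvalVl !eqxx.
Qed.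
Lemma unit_one_subproof : (1 * 1 == 1 :> A) && (1 * 1 == 1 :> A).
Proof. by rewrite mulr1 eqxx. Qed.
Lemma unit_inv_subproof u : (uval_inv u * uval u == 1) && (uval u * uval_inv u == 1).
Proof. by rewrite uvalV uvalVl !eqxx. Qed.

Let mul u v := unit_pair (unit_mul_subproof u v).
Let one := unit_pair unit_one_subproof.
Let inv u := unit_pair (unit_inv_subproof u).

Let mulA : associative mul. Proof. by move=> u v w; apply/uval_inj/mulrA. Qed.
Let mul1 : left_id one mul. Proof. by move=> u; apply/uval_inj/mul1r. Qed.
Let mul1' : right_id one mul. Proof. by move=> u; apply/uval_inj/mulr1. Qed.
Let mulV : left_inverse one inv mul. Proof. by move=> u; apply/uval_inj/uvalVl. Qed.
Let mulV' : right_inverse one inv mul. Proof. by move=> u; apply/uval_inj/uvalV. Qed.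

HB.instance Definition _ := isGroup.Build unit_group mulA mul1 mul1' mulV mulV'.

Lemma uval1 : uval 1%g = 1. Proof. by []. Qed.
Lemma uvalM u v : uval (u * v)%g = uval u * uval v. Proof. by []. Qed.
Lemma uvalX u n : uval (u ^+ n)%g = uval u ^+ n.
Proof. by elim: n => [|n IHn] //; rewrite expgS uvalM IHn exprS. Qed.

End UnitGroup.

Section GradedUnits.
Local Open Scope ring_scope.
Variables (K : groupType) (A : nzRingType) (j : K -> A) (p : nat).
Hypotheses (charA : p \in [pchar A]) (j1 : j 1%g = 1)
  (jM : {morph j : x y / (x * y)%g >-> x * y}).

Let p_pr : prime p. Proof. by case/andP: charA. Qed.

Lemma jX x n : j (x ^+ n)%g = j x ^+ n.
Proof. by elim: n => [|n IHn] //; rewrite expgS jM IHn exprS. Qed.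

(** A deformation of [y]: it equals [j y] at X = 1 and is 1 modulo X^w. *)
Definition graded_unit (y : K) (w : nat) : {poly A} := 1 + (j y - 1)%:P * 'X^w.

Lemma graded_unit1 w : graded_unit 1%g w = 1.
Proof. by rewrite /graded_unit j1 subrr mul0r addr0. Qed.

Lemma graded_unit_eval y w : (graded_unit y w).[1] = j y.
Proof.
rewrite /graded_unit hornerD hornerC hornerCM hornerXn expr1n mulr1 addrC.
by rewrite subrK.
Qed.

(** Frobenius is additive on commuting elements; it applies to 1 and the monomial, then to [j y] and
    1. The weight gets multiplied by [p]. *)
Lemma graded_unitXp y w : graded_unit y w ^+ p = graded_unit (y ^+ p)%g (w * p).
Proof.
have charP : p \in [pchar {poly A}] by rewrite pchar_poly.
have subXp : (j y - 1) ^+ p = j (y ^+ p)%g - 1.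
  have := pFrobenius_autB_comm charA (x := j y) (y := 1) (commr1 _).
  by rewrite !pFrobenius_autE expr1n jX.
have := pFrobenius_autD_comm charP (x := 1) (y := (j y - 1)%:P * 'X^w) (commr_sym (commr1 _)).
rewrite !pFrobenius_autE expr1n => ->; rewrite /graded_unit; congr (1 + _).
by rewrite exprMn_comm; [rewrite -polyC_exp subXp exprM | apply: commr_polyXn].
Qed.

Lemma graded_unitXpn y w n :
  graded_unit y w ^+ (p ^ n) = graded_unit (y ^+ (p ^ n))%g (w * p ^ n).
Proof.
elim: n => [|n IHn]; first by rewrite expn0 expr1 muln1.
by rewrite expnSr exprM IHn graded_unitXp -expgnA mulnA.
Qed.

Lemma graded_unit_exists y w n : (y ^+ (p ^ n) = 1)%g ->
  exists u : unit_group {poly A}, uval u = graded_unit y w.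
Proof.
move=> yn; have En : graded_unit y w ^+ (p ^ n) = 1.
  by rewrite graded_unitXpn yn graded_unit1.
(* The inverse is the power with exponent [p ^ n - 1]. *)
have [m mE] : exists m, (p ^ n)%N = m.+1.
  by exists (p ^ n).-1; rewrite prednK // expn_gt0 prime_gt0.
apply: (@unit_group_exists _ _ (graded_unit y w ^+ m)).
  by rewrite -exprS -mE En.
by rewrite -exprSr -mE En.
Qed.

(** Units congruent to 1 modulo X^(i+1); level [i] is to bound [gamma i.+1]. *)
Definition unit_level (i : nat) : set (unit_group {poly A}) :=
  [set u | exists Q : {poly A}, uval u = 1 + Q * 'X^(i.+1)].

Lemma graded_unit_level u y w : (0 < w)%N -> uval u = graded_unit y w ->
  unit_level 0 u.
Proof.
case: w => // w _ uE; exists ((j y - 1)%:P * 'X^w).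
by rewrite uE -mulrA -exprSr.
Qed.

Lemma unit_level_subgroup i : subgroup (unit_level i).
Proof.
split.
- by exists 0; rewrite mul0r addr0.
- move=> u v [P uE] [Q vE]; exists (P + Q + P * 'X^(i.+1) * Q).
  rewrite uvalM uE vE mulrDl mul1r mulrDr mulr1 !mulrDl !mulrA.
  by rewrite -!addrA; congr (1 + _); rewrite addrCA.
(* From u^-1 u = 1 and u = 1 + Q X^(i+1) follows u^-1 = 1 - u^-1 Q X^(i+1). *)
move=> u [Q uE]; exists (- uval (u^-1)%g * Q).
have := uvalM (u^-1)%g u; rewrite mulVg uval1 uE mulrDr mulr1 => /eqP.
by rewrite eq_sym => /eqP <-; rewrite mulNr mulNr mulrA addrK.
Qed.

(** With w = (v u)^-1 the commutator is w u v, and u v differs from v u by (P Q - Q P) X^(i+2)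
    because X is central. *)
Lemma unit_level_commg i u v : unit_level i u -> unit_level 0 v ->
  unit_level i.+1 [~ u, v]%g.
Proof.
move=> [P uE] [Q vE]; set w := (u^-1 * v^-1)%g.
have -> : ([~ u, v] = w * (u * v))%g by rewrite commgEl conjgE /w !mulgA.
have swap (a b : {poly A}) : (1 + a) * (1 + b) = (1 + b) * (1 + a) + (a * b - b * a).
  rewrite !mulrDl !mulrDr !mul1r !mulr1 -!addrA; congr (1 + _).
  by rewrite (addrC (b * a)) subrK addrCA.
have mulXX m n (S S' : {poly A}) :
    S * 'X^m * (S' * 'X^n) = S * S' * 'X^(m + n).
  by rewrite mulrA -(mulrA S) -commr_polyXn mulrA -mulrA -exprD.
have uvE : uval (u * v)%g = uval (v * u)%g + (P * Q - Q * P) * 'X^(i.+2).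
  by rewrite !uvalM uE vE swap !mulXX addnC -mulrBl.
exists (uval w * (P * Q - Q * P)).
rewrite uvalM uvE mulrDr -uvalM mulrA; congr (_ + _).
by rewrite /w -invgM mulVg.
Qed.

Lemma unit_level_bigcap u : (forall i, unit_level i u) -> u = 1%g.
Proof.
move=> ulev; apply: uval_inj; rewrite uval1; apply/eqP; rewrite -subr_eq0; apply/eqP.
apply/polyP => i; rewrite coef0; have [Q ->] := ulev i.
by rewrite addrAC subrr add0r coefMXn ltnSn.
Qed.

(** Evaluation at X = 1 is multiplicative even over a noncommutative [A], because the point 1 is
    central. *)
Definition evaluates (u : unit_group {poly A}) (x : K) := (uval u).[1] = j x.

Lemma evaluatesM u v x y :
  evaluates u x -> evaluates v y -> evaluates (u * v)%g (x * y)%g.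
Proof.
rewrite /evaluates => ux vy; rewrite uvalM hornerM_comm ?jM ?ux ?vy //.
by rewrite /comm_poly mul1r mulr1.
Qed.

Lemma evaluatesV u x : evaluates u x -> evaluates u^-1%g x^-1%g.
Proof.
rewrite /evaluates => ux; have : (uval (u^-1 * u)%g).[1] = 1.
  by rewrite mulVg hornerC.
rewrite uvalM hornerM_comm ?ux; last by rewrite /comm_poly mul1r mulr1.
move=> /(congr1 (fun z => z * j (x^-1)%g)); rewrite -mulrA -jM mulgV j1 mulr1.
by rewrite mul1r.
Qed.

Lemma evaluates_zexp u x n : evaluates u x -> evaluates (zexp u n) (zexp x n).
Proof.
have ev1 : evaluates 1%g 1%g by rewrite /evaluates j1 hornerC.
move=> ux; have evX k : evaluates (u ^+ k)%g (x ^+ k)%g.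
  by elim: k => [|k IHk] //; rewrite !expgS; apply: evaluatesM.
by case: n => k; [apply: evX | apply: evaluatesV; apply: evX].
Qed.

End GradedUnits.

(** * Homomorphisms to p-power torsion *)

Lemma zexp1g (G : groupType) n : zexp (1 : G) n = 1.
Proof. by case: n => n /=; rewrite expg1n ?invg1. Qed.

(** By Bezout, [t] inverts [s] modulo [n]. Chosen before the group, it serves everywhere to cancel
    [s]-th powers of elements killed by [n]. *)
Lemma inverse_exponent_exists (s : int) n : coprime `|s| n ->
  exists t : int, forall (G : groupType) (y : G), y ^+ n = 1 -> zexp y (s * t)%R = y.
Proof.
move=> co_sn; have [t [v tv]] := Bezoutz s n.
have gcd1 : gcdz s n = 1%R by rewrite /gcdz (eqP co_sn).
exists t => G y yn; have -> : (s * t)%R = (1 + n%:Z * (- v))%R.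
  by rewrite -gcd1 -tv; ring.
by rewrite zexpD zexpMl yn zexp1g mulg1.
Qed.

Lemma int_p_part p (z : int) : prime p -> z != 0%R ->
  exists s : int, z = (s * (p ^ logn p `|z|)%N%:Z)%R /\ coprime p `|s|.
Proof.
move=> p_pr z0; have [|m co_pm zE] := pfactor_coprime p_pr (n := `|z|).
  by rewrite absz_gt0.
exists ((-1) ^+ (z < 0)%R * m%:Z)%R; split.
  by rewrite -mulrA -PoszM -zE -intEsign.
by rewrite abszM absz_nat abszX /= exp1n mul1n.
Qed.

Section TreeHomomorphisms.
Variable T : labeled_tree.

Lemma gbs_gen_edge (u v : vertex T) : edge u v ->
  zexp (gbs_gen u) (label u v) = zexp (gbs_gen v) (label v u).
Proof.
move=> uv; rewrite -!word_value_exp -!word_classE.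
by apply/word_classP; apply: (WRel (r := (_, _))); exists u, v.
Qed.

Lemma gbs_lift (H : groupType) (f : vertex T -> H) :
  (forall u v, edge u v -> zexp (f u) (label u v) = zexp (f v) (label v u)) ->
  exists F : {hom gbs T -> H}, forall v, F (gbs_gen v) = f v.
Proof.
move=> fE; have [|F FE] := presented_lift (R := @gbs_relations T) (f := f).
  by move=> _ [u [v [uv ->]]]; rewrite /= !word_value_exp fE.
by exists F => v; rewrite FE /word_value big_seq1.
Qed.

Lemma gbs_ind (P : set (gbs T)) : subgroup P -> (forall v, P (gbs_gen v)) ->
  forall g, P g.
Proof. exact: presented_ind. Qed.

(* x_v is sent to (1 + (y' - 1) X^w)^s in the polynomials over the group ring,
   where y'^s = f(x_v) and rho_v = s w with w a power of p: the weights w make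
   the edge relations homogeneous, so that commutators raise the degree, and
   evaluation at X = 1 recovers f. *)
Lemma p_power_hom_gamma_omega (K : groupType) (f : {hom gbs T -> K}) p M
    (rho : vertex T -> int) : prime p -> (forall v, rho v != 0%R) ->
    (forall u v, edge u v -> (rho u * label u v = rho v * label v u)%R) ->
    (forall v, f (gbs_gen v) ^+ (p ^ M) = 1) ->
  forall g, gamma_omega (gbs T) g -> f g = 1.
Proof.
move=> p_pr rho0 rhoE fM.
have [A [j [charA j1 jM j_inj]]] := group_ring_exists K p_pr.
have [s sP] := choice (fun v => int_p_part p_pr (rho0 v)).
pose r v := logn p `|rho v|.
have rhoP v : rho v = (s v * (p ^ r v)%N%:Z)%R by have [] := sP v.
have co_s v : coprime p `|s v| by have [] := sP v.
have co_root (z : int) : coprime p `|z| -> coprime `|z| (p ^ M).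
  by move=> co; rewrite coprime_sym coprimeXl.
(* Since [t v] inverts [s v] modulo [p ^ M], the element [y v] below is an [s v]-th root of the
   image of x_v. *)
have [t tP] := choice (fun v => inverse_exponent_exists (co_root _ (co_s v))).
pose y v := zexp (f (gbs_gen v)) (t v).
have yM v : y v ^+ (p ^ M) = 1 by rewrite -zexpMn mulrC zexpMl fM zexp1g.
have yE v : zexp (y v) (s v) = f (gbs_gen v).
  by rewrite -zexpM mulrC tP ?fM.
have /choice[e eE] v : exists u : unit_group {poly A},
    uval u = graded_unit j (y v) (p ^ r v).
  by apply: (graded_unit_exists charA j1 jM _ (yM v)).
have [|D DE] := @gbs_lift _ (fun v => zexp (e v) (s v)).
  move=> u v uv; have luv := label_neq0 uv.
  have lvu : label v u != 0%R by apply: label_neq0; rewrite edge_sym.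
  have [m [mE co_m]] := int_p_part p_pr luv.
  have [m' [mE' co_m']] := int_p_part p_pr lvu.
  set a := logn p _ in mE; set b := logn p _ in mE'.
  (* The edge identity for [rho] is split into its p-adic valuations and its p-free parts. *)
  have rab : (r u + a = r v + b)%N.
    have := congr1 (fun z => logn p (absz z)) (rhoE u v uv).
    by rewrite !abszM !lognM ?absz_gt0.
  have smE : (s u * m = s v * m')%R.
    have := rhoE u v uv; rewrite mE mE' !rhoP => H.
    have pn0 : ((p ^ (r u + a))%N%:Z != 0)%R by rewrite -lt0n expn_gt0 prime_gt0.
    apply: (mulIf pn0); rewrite {2}rab !expnD !PoszM.
    by move: H; rewrite mulrACA => ->; rewrite mulrACA.
  (* Raising to the power [s u * m], prime to [p], is injective on elements killed by [p ^ M] and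
     turns both sides into the image under [f] of the edge relation. *)
  have ye : y u ^+ (p ^ a) = y v ^+ (p ^ b).
    have co_sm : coprime p `|(s u * m)%R| by rewrite abszM coprimeMr co_s.
    have [k kP] := inverse_exponent_exists (co_root _ co_sm).
    have powM w c : (y w ^+ (p ^ c)) ^+ (p ^ M) = 1.
      by rewrite -expgnA mulnC expgnA yM expg1n.
    rewrite -(kP _ _ (powM u a)) -(kP _ _ (powM v b)) !(zexpM _ _ k); congr zexp.
    rewrite {2}smE -!zexpMl !(mulrC (Posz _)) -!mulrA -mE -mE' !(zexpM _ (s _)) !yE.
    by rewrite -!hom_zexp gbs_gen_edge.
  (* By [ye] the base elements agree and by [rab] the weights do, so the two graded units
     coincide. *)
  have ee : e u ^+ (p ^ a) = e v ^+ (p ^ b).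
    apply: uval_inj; rewrite !uvalX !eE !(graded_unitXpn charA j1 jM) ye.
    by rewrite -!expnD rab.
  rewrite mE mE' -!zexpM !mulrA -smE !(mulrC (_ * _)%R (Posz _)) !zexpMl.
  by rewrite ee.
have D_eval g : evaluates j (D g) (f g).
  apply: (@gbs_ind [set g | evaluates j (D g) (f g)]).
    split=> /= [|x z Dx Dz|x Dx].
    - by rewrite /evaluates !gmulf1 j1 hornerC.
    - by rewrite !gmulfM; apply: (evaluatesM jM).
    - by rewrite !gmulfV; apply: (evaluatesV j1 jM).
  move=> v /=; rewrite DE -yE; apply: (evaluates_zexp j1 jM).
  by rewrite /evaluates eE graded_unit_eval.
(* Pulled back along [D], the levels form a filtration to which [gamma_sub] applies. *)
pose P i := [set g | unit_level i (D g)].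
have sP' i : subgroup (P i).
  have [L1 LM LV] := @unit_level_subgroup A i.
  split=> [|x z Dx Dz|x Dx]; rewrite /P /mkset.
  - by rewrite gmulf1; exact: L1.
  - by rewrite gmulfM; exact: LM.
  - by rewrite gmulfV; exact: LV.
have P0 : forall g, P 0 g.
  apply: (gbs_ind (sP' 0)) => v; rewrite /P /= DE.
  apply: subgroup_zexp; first exact: unit_level_subgroup.
  by apply: graded_unit_level (eE v); rewrite expn_gt0 prime_gt0.
have PS i x z : P i x -> P i.+1 [~ x, z].
  by move=> Px; rewrite /P /= gmulfR; apply: unit_level_commg => //; apply: P0.
move=> g g_omega; apply: j_inj; rewrite -[LHS]D_eval.
have -> : D g = 1; last by rewrite hornerC.
apply: unit_level_bigcap => i; apply: (gamma_sub sP' P0 PS (i := i)).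
exact: g_omega.
Qed.

End TreeHomomorphisms.

(** * Potentials on trees *)

Section TreePotential.
Variable T : labeled_tree.
Implicit Types (u v : vertex T) (A : {set vertex T}).

Definition edge_in A := [rel x y : vertex T | [&& edge x y, x \in A & y \in A]].

Lemma edge_in_sym A : symmetric (edge_in A).
Proof. by move=> x y /=; rewrite edge_sym; congr (_ && _); apply: andbC. Qed.

Definition connected_set A := {in A &, forall u v, connect (edge_in A) u v}.

(** A simple path inside [A] between two distinct neighbours of [v] would close up through [v] to a
    cycle of at least three vertices. *)
Lemma tree_unique_neighbor A u u' v : connected_set A -> v \notin A ->
  u \in A -> u' \in A -> edge v u -> edge v u' -> u' = u.
Proof.
move=> cA vA uA uA' vu vu'; have /connectP[p pathp lastp] := cA _ _ uA uA'.
move: lastp; case/shortenP: pathp => p' pathp' uniqp' _ lastp.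
have p'A : {subset u :: p' <= A}.
  move=> x; rewrite inE => /orP[/eqP -> //|].
  elim: p' u {vu cA uA uniqp' lastp} pathp' => //= y p' IHp' u /andP[/and3P[_ _ yA] pathp'].
  by rewrite inE => /orP[/eqP -> //|]; apply: IHp' pathp'.
have cyc : ucycle (@edge T) (v :: u :: p').
  apply/andP; split; last first.
    by rewrite cons_uniq uniqp' andbT; apply: contra vA; apply: p'A.
  rewrite /= vu rcons_path -lastp edge_sym vu' andbT.
  by apply: sub_path pathp' => x y /and3P[].
by have := edge_acyclic cyc; case: p' lastp {cyc pathp' uniqp' p'A}.
Qed.

Lemma tree_leaving_edge A u : u \in A -> A != [set: vertex T]%SET ->
  exists x y, [/\ x \in A, y \notin A & edge x y].
Proof.
move=> uA; apply: contraNP => noedge; apply/eqP/setP => v; rewrite inE.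
have clA : closed (@edge T) (mem A).
  apply: intro_closed; first exact: (sym_connect_sym (@edge_sym T)).
  move=> x y xy xA; apply: contraPT isT => yA; case: noedge.
  by exists x, y.
by rewrite -(closed_connect clA (edge_connected u v)).
Qed.

(** The equation says that sending x_v to rho_v respects the edge relations within [A], in the
    additive group of integers. Outside [A] the values are arbitrary nonzero integers. *)
Definition potential_on A (rho : vertex T -> int) :=
  (forall v, rho v != 0%R) /\
  {in A &, forall u v, edge u v -> (rho u * label u v = rho v * label v u)%R}.

(** A subtree grows by one vertex at a time; the new vertex has a single neighbour in it, hence
    brings only one new equation. *)
Lemma tree_potential_on n : n < #|vertex T| ->
  exists A, [/\ #|A| = n.+1, connected_set A & exists rho, potential_on A rho].
Proof.
elim: n => [|n IHn] n_lt.
  have /card_gt0P[u _] := n_lt; exists [set u]%SET; split; first by rewrite cards1.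
    by move=> x y /set1P -> /set1P ->; apply: connect0.
  exists (fun=> 1%R); split=> // x y /set1P -> /set1P ->.
  by rewrite edge_irr.
have [A [cardA cA [rho [rho0 rhoE]]]] := IHn (ltnW n_lt).
have /card_gt0P[u0 u0A] : 0 < #|A| by rewrite cardA.
have [|u [v [uA vA uv]]] := tree_leaving_edge u0A.
  by apply: contraTneq n_lt => AT; rewrite -cardA AT cardsT ltnn.
have vu : edge v u by rewrite edge_sym.
exists (v |: A)%SET; split; first by rewrite cardsU1 vA cardA.
  have sub : subrel (connect (edge_in A)) (connect (edge_in (v |: A)%SET)).
    apply: connect_sub => x y /and3P[xy xA yA]; apply: connect1.
    by rewrite /= xy !inE xA yA !orbT.
  have csym := sym_connect_sym (edge_in_sym (v |: A)%SET).
  have cu x : x \in (v |: A)%SET -> connect (edge_in (v |: A)%SET) u x.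
    move=> /setU1P[->|xA]; last exact/sub/cA.
    by apply: connect1; rewrite /= uv !inE uA eqxx orbT.
  by move=> x y /cu ux /cu uy; apply: connect_trans uy; rewrite csym.
(* Scaling the old values by [label v u] keeps the value at the new vertex [v] an integer. *)
exists (fun x => if x == v then rho u * label u v else rho x * label v u)%R.
have neq x : x \in A -> (x == v) = false.
  by move=> xA; apply: contraNF vA => /eqP <-.
have nbr x : x \in A -> edge v x -> x = u 
  by move=> xA; apply: tree_unique_neighbor cA vA uA xA vu.
split=> [x|x y].
  by rewrite /=; case: ifP => _; apply: mulf_neq0; rewrite ?rho0 ?label_neq0.
move=> /setU1P[->|xA] /setU1P[->|yA] xy.
- by rewrite edge_irr in xy.
- by rewrite (nbr y yA xy) eqxx neq // mulrAC.
- rewrite edge_sym in xy; by rewrite (nbr x xA xy) eqxx neq // mulrAC.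
- by rewrite !neq // mulrAC rhoE // mulrAC.
Qed.

Lemma tree_potential : exists rho : vertex T -> int, (forall v, rho v != 0%R) /\
  (forall u v, edge u v -> (rho u * label u v = rho v * label v u)%R).
Proof.
have [|A [cardA _ [rho [rho0 rhoE]]]] := @tree_potential_on #|vertex T|.-1.
  by rewrite ltn_predL vertex_gt0.
have AT : A = [set: vertex T]%SET.
  apply/eqP; rewrite eqEcard finset.subsetT cardsT cardA.
  by rewrite prednK ?leqnn // vertex_gt0.
exists rho; split; first exact: rho0.
by move=> u v; apply: rhoE; rewrite AT inE.
Qed.

End TreePotential.

(** * Prime components *)

Section PrimeComponents.
Implicit Types k l p q : nat.

Lemma common_primesP k l p : 0 < k -> 0 < l ->
  (p \in common_primes k l) = [&& prime p, p %| k & p %| l].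
Proof.
move=> k0 l0; rewrite mem_filter mem_primes k0 /= andbC -andbA.
by case: prime.
Qed.

Lemma common_primesC k l p : 0 < k -> 0 < l ->
  (p \in common_primes k l) = (p \in common_primes l k).
Proof. by move=> k0 l0; rewrite !common_primesP // (andbC (p %| k)). Qed.

Lemma common_primes_exists k l : 0 < k -> 0 < l -> ~~ coprime k l ->
  exists p, p \in common_primes k l.
Proof.
move=> k0 l0 nco; exists (pdiv (gcdn k l)); rewrite common_primesP //.
have g1 : 1 < gcdn k l by rewrite ltn_neqAle eq_sym nco gcdn_gt0 k0.
by rewrite pdiv_prime //= -dvdn_gcd pdiv_dvd.
Qed.

Lemma coprime_prime_dvd m n : 0 < m ->
  (forall r, prime r -> r %| m -> r %| n -> False) -> coprime m n.
Proof.
move=> m0 H; apply: contraT => nco.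
have g1 : 1 < gcdn m n by rewrite ltn_neqAle eq_sym nco gcdn_gt0 m0.
case: (H (pdiv (gcdn m n))); first exact: pdiv_prime.
  exact: dvdn_trans (pdiv_dvd _) (dvdn_gcdl _ _).
exact: dvdn_trans (pdiv_dvd _) (dvdn_gcdr _ _).
Qed.

Lemma prime_component_coprime p q k : prime p -> prime q -> p != q ->
  coprime (prime_component p k) q.
Proof.
by move=> p_pr q_pr pq; rewrite coprimeXl // prime_coprime // dvdn_prime2.
Qed.

Lemma coprime_prodr (I : Type) (s : seq I) (P : pred I) (F : I -> nat) m :
  (forall i, P i -> coprime m (F i)) -> coprime m (\prod_(i <- s | P i) F i).
Proof.
move=> mF; elim/big_rec: _ => [|i n Pi mn]; first exact: coprimen1.
by rewrite coprimeMr mF.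
Qed.

Lemma other_components_dvd p k l : other_components p k l %| l.
Proof.
rewrite /other_components; have : uniq (common_primes k l) by rewrite filter_uniq ?primes_uniq.
have : all prime (common_primes k l).
  by apply/allP => q; rewrite mem_filter mem_primes => /and3P[].
elim: (common_primes k l) => [|r s IHs] /=; first by rewrite big_nil dvd1n.
move=> /andP[r_pr s_pr] /andP[rs uniqs]; rewrite big_cons; case: ifP => _; last exact: IHs.
rewrite Gauss_dvd ?pfactor_dvdnn ?IHs //.
rewrite big_seq_cond coprime_prodr // => q /andP[qs _].
have q_pr := allP s_pr _ qs; rewrite coprimeXr // prime_component_coprime //.
by apply: contraNneq rs => ->.
Qed.

Lemma dvd_other_components p k l r : r \in common_primes k l -> r != p ->
  prime_component r l %| other_components p k l.
Proof.
move=> r_common rp; rewrite /other_components (big_rem r) //= rp.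
exact: dvdn_mulr.
Qed.

Lemma other_components_coprime p q k l : prime q ->
  (q == p) || (q \notin common_primes k l) -> coprime (other_components p k l) q.
Proof.
move=> q_pr Hq; rewrite /other_components coprime_sym big_seq_cond coprime_prodr //.
move=> r /andP[r_common rp]; rewrite coprime_sym prime_component_coprime //.
  by move: r_common; rewrite mem_filter mem_primes => /and3P[].
apply: contraTneq Hq => <-; rewrite negb_or rp r_common //.
Qed.

(** The quotient of [k] has lost its whole [p]-part; every other common prime has had its full power
    removed from [l]. *)
Lemma components_coprime p k l : 0 < k -> 0 < l -> p \in common_primes k l ->
  coprime (k %/ prime_component p k) (l %/ other_components p k l).
Proof.
move=> k0 l0 p_common; have ck : prime_component p k %| k by apply: pfactor_dvdnn.
have dl := other_components_dvd p k l.
have p_pr : prime p by move: p_common; rewrite common_primesP // => /and3P[].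
apply: coprime_prime_dvd => [|r r_pr rk rl].
  by rewrite divn_gt0; [apply: dvdn_leq | apply: (dvdn_gt0 k0)].
have notdvd m n s : 0 < n -> m %| n -> prime s -> prime_component s n %| m ->
    s %| n %/ m -> False.
  move=> n0 mn s_pr cm snm; have m0 := dvdn_gt0 n0 mn.
  have := dvdn_mul snm cm; rewrite divnK // /prime_component -expnS.
  by rewrite pfactor_dvdn // ltnn.
have [rp|rp] := eqVneq r p.
  by rewrite rp in rk; exact: (notdvd _ _ _ k0 ck p_pr (dvdnn _) rk).
apply: (notdvd _ _ _ l0 dl r_pr _ rl); apply: dvd_other_components rp.
rewrite common_primesP // r_pr.
by rewrite (dvdn_trans rk (dvdn_div ck)) (dvdn_trans rl (dvdn_div dl)).
Qed.

(** The Chinese remainder theorem gives [e], 1 modulo the [p]-part of [C] and 0 modulo the rest. If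
    x^C = 1, then x^e is the [p]-part of x. *)
Lemma prime_idempotent_exists C p : 0 < C -> prime p -> exists e,
  ((p ^ logn p C)%N%:Z %| (e%:Z - 1)%R)%Z /\ (forall d, d %| C -> coprime d p -> d %| e).
Proof.
move=> C0 p_pr; have [|m co_pm CE] := pfactor_coprime p_pr (n := C); first by [].
have co : coprime (p ^ logn p C) m by rewrite coprimeXl.
exists (chinese (p ^ logn p C) m 1 0); split.
  by rewrite -eqz_mod_dvd /= !modz_nat chinese_modl.
move=> d dC dp; apply: (@dvdn_trans m).
  by move: dC; rewrite {1}CE Gauss_dvdl // coprimeXr.
by rewrite /dvdn chinese_modr // mod0n.
Qed.

End PrimeComponents.

(** * Commutators of a pair *)

Section PairCommutators.
Variable G : groupType.
Implicit Types (a b x y : G) (k l p q e f : nat).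

Lemma commute_subgroup x : subgroup [set y | commute x y].
Proof.
split=> [|y z xy xz|y xy]; [exact: commute1|exact: commuteM|exact: commuteV].
Qed.

Lemma commute_powers a b e f c d :
  [~ a ^+ c, b ^+ d] = 1 -> c %| e -> d %| f -> commute (a ^+ e) (b ^+ f).
Proof.
move=> /eqP/commgP ab /dvdnP[m ->] /dvdnP[n ->].
by rewrite !(mulnC _ c) !(mulnC _ d) !expgnA; apply: commuteX2.
Qed.

(* For p <> q, the relations make the p-part of a commute with the q-part of b. *)
Lemma commutators_commute a b k l p q e f : 0 < k -> 0 < l ->
    (forall g, commutators a b k l g -> g = 1) -> prime p -> prime q -> p != q ->
    (forall d, d %| k -> coprime d p -> d %| e) ->
    (forall d, d %| l -> coprime d q -> d %| f) ->
  commute (a ^+ e) (b ^+ f).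
Proof.
move=> k0 l0; rewrite /commutators; case: ifPn => [_ ab1|nco ab1] p_pr q_pr pq de df.
  by apply/commuteX2/commgP/eqP/ab1.
(* For a common prime [q], its commutator of the first kind works: [a] is raised to a power of [q],
   prime to [p], and the exponent of [b] omits [q]. A common [p] is treated symmetrically by the
   second kind. *)
have [q_common|q_common] := boolP (q \in common_primes k l).
  have ab : [~ a ^+ prime_component q k, b ^+ other_components q k l] = 1.
    by apply: ab1; exists q => //; left.
  apply: (commute_powers ab).
    by apply: de; [exact: pfactor_dvdnn|rewrite prime_component_coprime // eq_sym].
  by apply: df; [exact: other_components_dvd|rewrite other_components_coprime ?eqxx].
have [p_common|p_common] := boolP (p \in common_primes k l).
  have ba : [~ b ^+ prime_component p l, a ^+ other_components p l k] = 1.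
    by apply: ab1; exists p => //; right.
  apply/commute_sym/(commute_powers ba).
    by apply: df; [exact: pfactor_dvdnn|rewrite prime_component_coprime].
  by apply: de; [exact: other_components_dvd|rewrite other_components_coprime ?eqxx].
(* When neither is common, any common prime [r] differs from both, and its commutator works. *)
have [r r_common] := common_primes_exists k0 l0 nco.
have r_pr : prime r by move: r_common; rewrite common_primesP // => /andP[].
have ab : [~ a ^+ prime_component r k, b ^+ other_components r k l] = 1.
  by apply: ab1; exists r => //; left.
apply: (commute_powers ab).
  apply: de; first exact: pfactor_dvdnn.
  by rewrite prime_component_coprime //; apply: contraNneq p_common => <-.
apply: df; first exact: other_components_dvd.
by rewrite other_components_coprime // q_common orbT.
Qed.

(** Raising further to the coprime exponents of [components_coprime] yields a^k and b^l, which
    commute with b and a respectively. *)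
Lemma component_commg_gamma_omega a b k l p : 0 < k -> 0 < l ->
    p \in common_primes k l -> commute (a ^+ k) b -> commute a (b ^+ l) ->
  gamma_omega G [~ a ^+ prime_component p k, b ^+ other_components p k l].
Proof.
move=> k0 l0 p_common akb abl.
have ck : prime_component p k %| k by apply: pfactor_dvdnn.
apply: (coprime_commg_gamma_omega (components_coprime k0 l0 p_common)).
  by rewrite -expgnA mulnC divnK //; apply: commuteX.
rewrite -[X in commute _ X]expgnA mulnC divnK ?other_components_dvd //.
by apply/commute_sym/commuteX/commute_sym.
Qed.

Lemma commutators_gamma_omega a b k l : 0 < k -> 0 < l ->
    commute (a ^+ k) b -> commute a (b ^+ l) ->
  commutators a b k l `<=` gamma_omega G.
Proof.
move=> k0 l0 akb abl g; rewrite /commutators; case: ifP => [co ->|_].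
  exact: coprime_commg_gamma_omega co akb abl.
move=> [p p_common [->|->]]; first exact: component_commg_gamma_omega.
by apply: component_commg_gamma_omega => //; rewrite common_primesC.
Qed.

Lemma commute_gen1 a b x : subgroup_gen [set b] x -> commute a b -> commute a x.
Proof. by move=> /subgroup_gen1P[n ->]; apply: commute_zexp. Qed.

Lemma pair_commutators_gamma_omega a b : pair_commutators a b `<=` gamma_omega G.
Proof.
move=> g [k [l [k0 l0 ak bl]]]; apply: commutators_gamma_omega => //.
  have [_ bk] : (subgroup_gen [set a] `&` subgroup_gen [set b]) (a ^+ k).
    by rewrite ak; apply: sub_gen_smallest.
  exact/commute_sym/(commute_gen1 bk).
have [al _] : (subgroup_gen [set a] `&` subgroup_gen [set b]) (b ^+ l).
  by rewrite bl; apply: sub_gen_smallest.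
exact: commute_gen1 al (commute_refl a).
Qed.

(** Take for [k] the least positive exponent with a^k in the subgroup of b; by Euclidean division it
    divides every such exponent, [C] included. *)
Lemma intersection_generator a b C : 0 < C -> subgroup_gen [set b] (a ^+ C) ->
  exists k, [/\ 0 < k, k %| C &
    subgroup_gen [set a] `&` subgroup_gen [set b] = subgroup_gen [set a ^+ k]].
Proof.
move=> C0 bC; have sb := subgroup_gen_subgroup [set b].
have [_ bM bV] := sb.
have exk : exists k, (0 < k) && `[< subgroup_gen [set b] (a ^+ k) >].
  by exists C; rewrite C0; apply/asboolP.
case: (ex_minnP exk) => k /andP[k0 /asboolP bk] k_min.
have kdvd n : subgroup_gen [set b] (a ^+ n) -> k %| n.
  move=> bn; apply: contraTT (ltn_pmod n k0); rewrite -leqNgt => nk.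
  apply: k_min; rewrite lt0n nk; apply/asboolP.
  suff -> : a ^+ (n %% k) = (a ^+ k ^+ (n %/ k))^-1 * a ^+ n.
    by apply: bM bn; apply: bV; apply: (subgroupX sb).
  by rewrite {3}(divn_eq n k) expgnDr mulnC expgnA mulKg.
exists k; split=> //; first exact: kdvd.
apply/seteqP; split=> x.
  move=> [/subgroup_gen1P[n ->] bn].
  have {}bn : subgroup_gen [set b] (a ^+ `|n|).
    by case: n bn => n // bn; rewrite -[a ^+ _]invgK; apply: bV.
  apply/subgroup_gen1P; have /dvdnP[m mE] := kdvd _ bn.
  case: n mE {bn} => n /= ->; first by exists m; rewrite mulnC expgnA.
  by exists (- m%:Z)%R; rewrite zexp_opp_nat mulnC expgnA.
move=> /subgroup_gen1P[n ->]; split; last exact: (subgroup_zexp sb).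
by apply/subgroup_gen1P; exists (k%:Z * n)%R; rewrite zexpMl.
Qed.

(** The exponents are made to divide [C] so that the idempotents modulo [C] apply to them. *)
Lemma pair_commutators_exists a b C : 0 < C ->
    subgroup_gen [set b] (a ^+ C) -> subgroup_gen [set a] (b ^+ C) ->
  exists k l, [/\ 0 < k, 0 < l, k %| C, l %| C &
    commutators a b k l `<=` pair_commutators a b].
Proof.
move=> C0 aC bC; have [k [k0 kC akE]] := intersection_generator C0 aC.
have [l [l0 lC blE]] := intersection_generator C0 bC.
exists k, l; split=> // g gab; exists k, l; split=> //.
by rewrite setIC.
Qed.

Lemma commutators_hom (K : groupType) (f : {hom G -> K}) a b k l h :
  commutators (f a) (f b) k l h -> exists2 g, commutators a b k l g & f g = h.
Proof.
rewrite /commutators; case: ifP => _; first by move=> ->; exists [~ a, b]; rewrite ?gmulfR.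
move=> [p p_common [->|->]].
  exists [~ a ^+ prime_component p k, b ^+ other_components p k l].
    by exists p => //; left.
  by rewrite gmulfR !gmulfXn.
exists [~ b ^+ prime_component p l, a ^+ other_components p l k].
  by exists p => //; right.
by rewrite gmulfR !gmulfXn.
Qed.

End PairCommutators.

(** Repetitions in [s] are excluded because the image of a single [f i] may be nonabelian. *)
Lemma hom_prod_morph (G K : groupType) (I : eqType) (f : I -> {hom G -> K}) s :
    uniq s ->
    {in s &, forall i j, i != j -> forall x y, commute (f i x) (f j y)} ->
  {morph (fun g => \prod_(i <- s) f i g) : x y / x * y}.
Proof.
move=> uniqs fC x y; elim: s uniqs fC => [|i s IHs] /=; first by rewrite !big_nil mulg1.
move=> /andP[is_ uniqs] fC; rewrite !big_cons IHs //; last first.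
  by move=> j k js ks; apply: fC; rewrite inE ?js ?ks orbT.
rewrite gmulfM -!mulgA; congr (_ * _); rewrite !mulgA; congr (_ * _).
rewrite big_seq; apply: commute_prod => j js; apply: fC.
- by rewrite inE eqxx.
- by rewrite inE js orbT.
- by apply: contraNneq is_ => ->.
Qed.

(** * The torsion quotient and gamma_omega *)

Lemma rat_units_commute (u v : unit_group rat) : commute u v.
Proof. by apply: uval_inj; rewrite /commute !uvalM mulrC. Qed.

Lemma hom_commute_gamma_omega (G H : groupType) (f : {hom G -> H}) :
  (forall x y : H, commute x y) -> forall g, gamma_omega G g -> f g = 1.
Proof.
move=> HC g g_omega; have [sker _] := hom_ker_normal f.
apply: (smallest_sub sker _ (g_omega 2 isT)) => _ [x _ [y _ <-]] /=.
by rewrite gmulfR; apply/eqP/commgP.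
Qed.

(** The powers of 2 are a multiplicative copy of the integers, in which potentials become
    homomorphisms. *)
Lemma rat_unit2_exists : exists u : unit_group rat,
  forall n, zexp u n = 1 -> n = 0%R.
Proof.
have [||u uE] := @unit_group_exists rat 2%R 2%R^-1%R.
- by rewrite mulfV.
- by rewrite mulVf.
have uX n : u ^+ n = 1 -> n = 0%N.
  move=> /(congr1 (@uval rat)); rewrite uvalX uE uval1 => /eqP.
  by case: n => // n; rewrite pexpr_eq1.
exists u => -[n|n] /= un; first by rewrite (uX n).
by have /uX : u ^+ n.+1 = 1 by rewrite -[LHS]invgK un invg1.
Qed.

Section GeneralizedBaumslagSolitar.
Variable T : labeled_tree.
Implicit Types u v : vertex T.

Lemma gbs_hom_commute (K : groupType) (f h : {hom gbs T -> K}) :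
  (forall u v, commute (f (gbs_gen u)) (h (gbs_gen v))) ->
  forall x y, commute (f x) (h y).
Proof.
move=> fh x y; apply: (@gbs_ind T [set y | commute (f x) (h y)]).
  by split=> /= [|a b fa fb|a fa];
    rewrite ?gmulf1 ?gmulfM ?gmulfV; [exact: commute1|exact: commuteM|exact: commuteV].
move=> v /=; apply: commute_sym.
apply: (@gbs_ind T [set x | commute (h (gbs_gen v)) (f x)]) => [|u /=].
  by split=> /= [|a b fa fb|a fa];
    rewrite ?gmulf1 ?gmulfM ?gmulfV; [exact: commute1|exact: commuteM|exact: commuteV].
exact/commute_sym/fh.
Qed.

Lemma gbs_hom_eq (K : groupType) (f h : gbs T -> K) :
    {morph f : x y / x * y} -> {morph h : x y / x * y} ->
  (forall v, f (gbs_gen v) = h (gbs_gen v)) -> f =1 h.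
Proof.
move=> /morph_hom[f' fE] /morph_hom[h' hE] fh g; rewrite -fE -hE.
apply: (@gbs_ind T [set g | f' g = h' g]) => [|v /=]; last by rewrite fE hE.
split=> /= [|x y fx fy|x fx]; first by rewrite !gmulf1.
  by rewrite !gmulfM fx fy.
by rewrite !gmulfV fx.
Qed.

(** Each relation equates powers of single generators, so it survives raising the images of all
    generators to the power [e]. *)
Lemma gbs_power_hom (K : groupType) (f : {hom gbs T -> K}) e :
  exists F : {hom gbs T -> K}, forall v, F (gbs_gen v) = f (gbs_gen v) ^+ e.
Proof.
apply: gbs_lift => u v uv; rewrite -!zexpMl ![(e%:Z * _)%R]mulrC !zexpMn.
by rewrite -!hom_zexp gbs_gen_edge.
Qed.

Section Potential.
Variable rho : vertex T -> int.
Hypotheses (rho0 : forall v, rho v != 0%R)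
  (rhoE : forall u v, edge u v -> (rho u * label u v = rho v * label v u)%R).

Lemma gbs_common_power : exists (C : nat) (m : vertex T -> int) (z : gbs T),
  [/\ 0 < C, (forall v, (rho v * m v = C%:Z)%R) & forall v, zexp (gbs_gen v) (m v) = z].
Proof.
pose D := (\prod_v `|rho v|)%N.
pose E := (\prod_(uv : vertex T * vertex T | edge uv.1 uv.2) `|label uv.1 uv.2|)%N.
have D0 : 0 < D by rewrite prodn_gt0 // => v; rewrite absz_gt0.
have E0 : 0 < E by rewrite prodn_cond_gt0 // => uv uvE; rewrite absz_gt0 label_neq0.
have rhoD v : (`|rho v| %| D)%N by rewrite /D (bigD1 v) //= dvdn_mulr.
have labelE u v : edge u v -> (`|label u v| %| E)%N.
  by move=> uv; rewrite /E (bigD1 (u, v)) //= dvdn_mulr.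
(* [C] is a multiple of every rho_u * label u v, and the quotient [t] is the same seen from both
   ends of the edge; hence the powers of x_u and x_v agree. *)
pose C := (D * E)%N; pose m v := (Posz C %/ rho v)%Z.
have mE v : (rho v * m v)%R = (C%:Z)%R.
  by rewrite mulrC divzK // dvdzE /= dvdn_mulr.
have edge_z u v : edge u v -> zexp (gbs_gen u) (m u) = zexp (gbs_gen v) (m v).
  move=> uv; have /dvdzP[t tE] : (rho u * label u v %| Posz C)%Z.
    by rewrite dvdzE /= abszM dvdn_mul ?labelE.
  have -> : m u = (label u v * t)%R.
    by apply: (mulfI (rho0 u)); rewrite mE tE [RHS]mulrA [RHS]mulrC.
  have -> : m v = (label v u * t)%R.
    by apply: (mulfI (rho0 v)); rewrite mE tE rhoE // [RHS]mulrA [RHS]mulrC.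
  by rewrite !zexpM gbs_gen_edge.
have /card_gt0P[v0 _] := vertex_gt0 T.
exists C, m, (zexp (gbs_gen v0) (m v0)); split=> // [|v]; first by rewrite muln_gt0 D0.
have /connectP[p pathp ->] := edge_connected v0 v.
elim: p v0 pathp => //= x p IHp v0 /andP[v0x pathp].
by rewrite IHp // (edge_z _ _ v0x).
Qed.

(** The target is abelian and [rho] is nonzero, so this detects that z has infinite order in the
    abelianization. *)
Lemma gbs_potential_hom : exists f : {hom gbs T -> unit_group rat},
  forall v n m, zexp (f (zexp (gbs_gen v) m)) n = 1 -> (rho v * m * n = 0)%R.
Proof.
have [u u1] := rat_unit2_exists.
have [x y xy|f fE] := @gbs_lift T _ (fun v => zexp u (rho v)).
  by rewrite -!zexpM rhoE.
by exists f => v n m; rewrite hom_zexp fE -!zexpM => /u1; rewrite ?mulrA.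
Qed.

End Potential.

Lemma gbs_central (z : gbs T) : (forall v, exists n, zexp (gbs_gen v) n = z) ->
  forall g, commute z g.
Proof.
move=> zP; apply: gbs_ind => [|v]; first exact: commute_subgroup.
by have [n <-] := zP v; apply/commute_sym/commute_zexp/commute_refl.
Qed.

(* Modulo z the group is generated by commuting subgroups, one for each prime p,
   generated by the p-parts of the x_v; the homomorphisms onto them kill
   gamma_omega, and their product is the projection. *)
Lemma gamma_omega_torsion_quotient (K : groupType) (f : {hom gbs T -> K}) C :
    0 < C -> (forall v, f (gbs_gen v) ^+ C = 1) ->
    (forall u v, u != v -> subgroup_gen [set gbs_gen v] (gbs_gen u ^+ C)) ->
    (forall g, gbs_commutators T g -> f g = 1) ->
  forall g, gamma_omega (gbs T) g -> f g = 1.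
Proof.
move=> C0 fC pairC fS g g_omega.
have [rho [rho0 rhoE]] := tree_potential T.
have eP p : exists e, prime p -> ((p ^ logn p C)%N%:Z %| (e%:Z - 1)%R)%Z /\
    (forall d, d %| C -> coprime d p -> d %| e).
  (* Non-primes get the dummy exponent 0, so that [choice] applies. *)
  have [p_pr|np] := boolP (prime p); last by exists 0%N.
  by have [e ?] := prime_idempotent_exists C0 p_pr; exists e.
have {eP} [e eP] := choice eP.
have [phi phiE] := choice (fun p => gbs_power_hom f (e p)).
(* The p-free part of [C] divides [e p], so the [p]-part of [C] kills the image of each generator
   under [phi p]. *)
have phi_omega p : p \in primes C -> phi p g = 1.
  rewrite mem_primes => /and3P[p_pr _ pC]; have [_ edvd] := eP p p_pr.
  apply: (p_power_hom_gamma_omega p_pr rho0 rhoE (M := logn p C)) => // v.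
  have [|m co_pm CE] := pfactor_coprime p_pr (n := C); first by [].
  have /dvdnP[t tE] : m %| e p by apply: edvd; [rewrite CE dvdn_mulr|rewrite coprime_sym].
  by rewrite phiE tE -!expgnA -mulnA -CE mulnC expgnA fC expg1n.
have phiC p q x y : prime p -> prime q -> p != q -> commute (phi p x) (phi q y).
  move=> p_pr q_pr pq; apply: gbs_hom_commute => u v; rewrite !phiE.
  have [<-|uv] := eqVneq u v; first exact/commuteX2/commute_refl.
  have [|k [l [k0 l0 kC lC kl]]] := pair_commutators_exists C0 (pairC u v uv).
    by apply: pairC; rewrite eq_sym.
  apply: (commutators_commute k0 l0 _ p_pr q_pr pq).
  - move=> h /commutators_hom[h' h'E <-]; apply: fS; exists u, v; split=> //.
    exact: kl.
  - by move=> d dk; apply: (eP p p_pr).2; apply: dvdn_trans dk kC.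
  - by move=> d dl; apply: (eP q q_pr).2; apply: dvdn_trans dl lC.
have primesC p : p \in primes C -> prime p by rewrite mem_primes => /andP[].
(* Comparing the two homomorphisms on generators amounts to the sum of the [e p] being 1 modulo
   [C]. *)
have -> : f g = \prod_(p <- primes C) phi p g; last first.
  by rewrite big_seq big1 // => p /phi_omega.
apply: (gbs_hom_eq (h := fun g => \prod_(p <- primes C) phi p g)); first exact: gmulfM.
  apply: (hom_prod_morph (primes_uniq C)) => p q /primesC p_pr /primesC q_pr pq x y.
  exact: phiC.
move=> v; under eq_bigr do rewrite phiE.
rewrite prodgXr; set s := (\sum_(p <- _) _)%N.
suff /dvdnP[t tE] : C %| `|(s%:Z - 1)%R|.
  have -> : f (gbs_gen v) ^+ s = zexp (f (gbs_gen v)) ((s%:Z - 1) + 1)%R.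
    by rewrite subrK.
  rewrite zexpD zexp1; suff -> : zexp (f (gbs_gen v)) (s%:Z - 1)%R = 1 by rewrite mul1g.
  have fCt : f (gbs_gen v) ^+ (t * C) = 1 by rewrite mulnC expgnA fC expg1n.
  by move: tE; case: (s%:Z - 1)%R => n /= ->; rewrite fCt ?invg1.
(* One prime [q] at a time: modulo the [q]-part of [C], [e q] is 1 and every other [e p] is 0. *)
apply/dvdn_partP => // q; rewrite /= => q_C; rewrite p_part.
have q_primes : q \in primes C by [].
have q_pr := primesC q q_primes.
suff : ((q ^ logn q C)%N%:Z %| (s%:Z - 1)%R)%Z by rewrite dvdzE.
rewrite /s (big_rem q) //= PoszD addrAC rpredD //; first exact: (eP q q_pr).1.
rewrite dvdzE /= big_seq dvdn_sum // => p; rewrite mem_rem_uniq ?primes_uniq //.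
rewrite inE => /andP[pq /primesC p_pr]; apply: (eP p p_pr).2; first exact: pfactor_dvdnn.
by rewrite coprimeXl // prime_coprime // dvdn_prime2 // eq_sym.
Qed.

End GeneralizedBaumslagSolitar.

Lemma central_extension_normal (G : groupType) (N : set G) (z : G) :
    normal_subgroup N -> (forall g, commute z g) ->
  normal_subgroup [set g | exists n t, N n /\ g = n * zexp z t].
Proof.
move=> [[N1 NM NV] NJ] zC.
have zCX t g : zexp z t * g = g * zexp z t.
  exact/commute_sym/commute_zexp/commute_sym/zC.
split; first split.
- by exists 1, 0%R; rewrite mulg1.
- move=> _ _ [m [s [Nm ->]]] [n [t [Nn ->]]]; exists (m * n), (s + t)%R.
  by split; [apply: NM | rewrite zexpD -!mulgA; congr (_ * _); rewrite !mulgA zCX].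
- move=> _ [n [t [Nn ->]]]; exists n^-1, (- t)%R.
  by split; [apply: NV | rewrite invgM -zexpN zCX].
- move=> _ y [n [t [Nn ->]]]; exists (n ^ y), t; split; first exact: NJ.
  by rewrite conjMg (conjgE (zexp z t)) zCX mulKg.
Qed.

Theorem theorem3p5 (T : labeled_tree) :
  gamma_omega (gbs T) = normal_closure (gbs_commutators T).
Proof.
have S_omega : normal_closure (gbs_commutators T) `<=` gamma_omega (gbs T).
  apply: smallest_sub; first exact: gamma_omega_normal.
  by move=> g [u [v [_ ]]]; apply: pair_commutators_gamma_omega.
apply/seteqP; split=> // g g_omega.
have nS := normal_closure_normal (gbs_commutators T).
have [rho [rho0 rhoE]] := tree_potential T.
have [C [m [z [C0 mE zE]]]] := gbs_common_power rho0 rhoE.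
have zC : forall h, commute z h.
  by apply: gbs_central => v; exists (m v).
have [K [f kerf]] := quotient_exists (central_extension_normal nS zC).
(* As C = rho_v m_v, this power is a power of z: it dies in [K], and it lies in every vertex
   group. *)
have zX v : gbs_gen v ^+ C = zexp z (rho v).
  have -> : gbs_gen v ^+ C = zexp (gbs_gen v) C by [].
  by rewrite -(mE v) mulrC zexpM zE.
have fg : f g = 1.
  apply: (gamma_omega_torsion_quotient C0) g_omega => [v|u v _|h hS].
  - rewrite -gmulfXn; apply/kerf; exists 1, (rho v).
    split; first by case: nS => -[].
    by rewrite mul1g zX.
  - apply/subgroup_gen1P; exists (m v * rho u)%R.
    by rewrite zX zexpM zE.
  - apply/kerf; exists h, 0%R; rewrite mulg1; split=> //; exact: sub_gen_smallest.
have /kerf[n [t [Nn gE]]] := fg.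
have [h hE] := gbs_potential_hom rhoE.
have /card_gt0P[v _] := vertex_gt0 T.
suff t0 : t = 0%R by rewrite gE t0 mulg1.
(* Both [g] and [n] lie in [gamma_omega], hence so does z^t, which [h] then kills. *)
have hz : zexp (h (zexp (gbs_gen v) (m v))) t = 1.
  rewrite zE -hom_zexp; apply: (@hom_commute_gamma_omega _ _ h rat_units_commute).
  have [[_ omegaM omegaV] _] := gamma_omega_normal (gbs T).
  rewrite -[zexp z t](mulKg n) -gE; apply: omegaM g_omega.
  exact/omegaV/S_omega.
have /eqP := hE v t (m v) hz; rewrite mE mulf_eq0 => /orP[|/eqP //].
by rewrite eqz_nat -leqn0 leqNgt C0.
Qed.
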